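(* Let $A^*\in\mathbb{R}_+^{n\times m}$ have all rows of $\ell_1$-norm $1$, let $B^*\in\mathbb{R}^{q\times p}$, and let $M_t=A^*X_tB^*$ for $t\in\{1,\dots,T\}$, where the design matrices $X_1,\dots,X_T$ form a generating (spanning) family of $\mathbb{R}^{m\times q}$. Let $\mathbb{C}\in\mathbb{R}^{mq\times np}$ be the matrix whose rows are the vectors $\mathrm{vec}(A^*E_{(k,l)}B^* )^\top$, $k\in[m]$, $l\in[q]$. Then: (i) for all $(l,j)\in[q]\times[p]$ and all $i\in[n]$, $\ [B^*]_{lj}=\sum_{k=1}^m[\mathbb{C}]_{(k,l)}^{(i,j)}$; (ii) for all $(i,k)\in[n]\times[m]$ and any $(l,j)\in[q]\times[p]$ such that $[B^*]_{lj}\ne0$, $\ [A^*]_{ik}=\dfrac{[\mathbb{C}]_{(k,l)}^{(i,j)}}{[B^*]_{lj}}$.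
   Context: $[N]=\{1,\dots,N\}$; $\mathrm{vec}(\cdot)$ denotes column-wise vectorization; $E_{(k,l)}\in\mathbb{R}^{m\times q}$ is the canonical basis matrix with entry $1$ at position $(k,l)$ and $0$ elsewhere. The row of $\mathbb{C}$ indexed by $(k,l)$ is row number $k+(l-1)m$, and $[\mathbb{C}]_{(k,l)}^{(i,j)}$ denotes the entry of $\mathbb{C}$ in row $k+(l-1)m$ and column $i+(j-1)n$. *)

(* Defs.v *)
From mathcomp Require Import all_boot all_order all_algebra.
From mathcomp Require Import reals.

Set Implicit Arguments.
Unset Strict Implicit.
Unset Printing Implicit Defensive.

Import GRing.Theory.
Local Open Scope ring_scope.

Lemma vec_index_subproof (a b : nat) (i : 'I_a) (j : 'I_b) :
  (i + j * a < a * b)%N.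
Proof.
apply: (@leq_trans (j.+1 * a)); first by rewrite mulSn ltn_add2r.
by rewrite mulnC leq_mul2l ltn_ord orbT.
Qed.

(* Ordinals start at 0, so this is the position i + (j - 1) a of the usual
   1-based numbering. *)
Definition vec_index (a b : nat) (i : 'I_a) (j : 'I_b) : 'I_(a * b) :=
  Ordinal (vec_index_subproof i j).

(* mxvec reads a matrix row by row, hence the transpose. *)
Definition vec (R : Type) (a b : nat) (A : 'M[R]_(a, b)) : 'cV[R]_(a * b) :=
  castmx (mulnC b a, erefl 1%N) (mxvec A^T)^T.

Lemma index_allpairs (S T : eqType) (s : seq S) (t : seq T) (x : S) (y : T) :
  x \in s -> y \in t ->
  index (x, y) [seq (x', y') | x' <- s, y' <- t]
    = (index x s * size t + index y t)%N.
Proof.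
move=> + yt; elim: s => // x' s IHs; rewrite in_cons /= index_cat size_map.
have [<-{x' IHs} _ | neq /= xs] := eqVneq x x'.
  by rewrite map_f // index_map // => ? ? [].
rewrite ifN ?IHs // ?mulSn ?addnA //.
by apply/mapP => -[y' _ [exx' _]]; rewrite exx' eqxx in neq.
Qed.

Lemma val_mxvec_index (a b : nat) (i : 'I_a) (j : 'I_b) :
  mxvec_index i j = (i * b + j)%N :> nat.
Proof.
have -> : mxvec_index i j = index (i, j) (enum {: 'I_a * 'I_b}) :> nat.
  by rewrite -[in RHS](enum_rankK (i, j)) index_uniq ?enum_uniq // -cardE.
rewrite enumT unlock index_allpairs ?mem_enum //.
by rewrite !index_enum_ord size_enum_ord.
Qed.

Lemma vecE (R : Type) (a b : nat) (A : 'M[R]_(a, b)) (i : 'I_a) (j : 'I_b) :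
  vec A (vec_index i j) 0 = A i j.
Proof.
rewrite castmxE mxE cast_ord_id.
rewrite (_ : cast_ord _ _ = mxvec_index j i) ?mxvecE ?mxE //.
by apply: ord_inj; rewrite val_mxvec_index /= addnC.
Qed.

(* Main.v *)
Require Import Defs.
From mathcomp Require Import all_boot all_order all_algebra.
From mathcomp Require Import reals.

Local Open Scope ring_scope.

(** The matrix [A *m delta_mx k l *m B] is the outer product of column [k] of [A] and row [l] of
    [B], so every entry of [C] is a single product [A i k * B l j] ([CE]). Summing over [k] leaves
    [B l j], because row [i] of [A] is nonnegative with l1-norm 1 and so sums to 1; dividing by a
    nonzero [B l j] leaves [A i k]. *)

Lemma mulmx_delta_mulE (R : pzSemiRingType) (n m q p : nat)
  (A : 'M[R]_(n, m)) (B : 'M[R]_(q, p))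
  (i : 'I_n) (k : 'I_m) (l : 'I_q) (j : 'I_p) :
  (A *m delta_mx k l *m B) i j = A i k * B l j.
Proof.
(* Factoring [delta_mx k l] as a column times a row through ['I_1] leaves a matrix product with a
   single summand. *)
rewrite -(mul_delta_mx (0 : 'I_1)) mulmxA -colE -mulmxA -rowE.
by rewrite mxE big_ord1 !mxE.
Qed.

Theorem proposition2p2 (R : realType) (n m q p T : nat)
  (A : 'M[R]_(n, m)) (B : 'M[R]_(q, p))
  (X : 'I_T -> 'M[R]_(m, q)) (M : 'I_T -> 'M[R]_(n, p))
  (C : 'M[R]_(m * q, n * p))
  (A_ge0 : forall i k, 0 <= A i k)
  (A_l1 : forall i, \sum_k `|A i k| = 1)
  (X_span : <<[seq X t | t : 'I_T]>>%VS = fullv)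
  (M_def : forall t, M t = A *m X t *m B)
  (C_def : forall (k : 'I_m) (l : 'I_q),
     row (vec_index k l) C = (vec (A *m delta_mx k l *m B))^T) :
  (forall (l : 'I_q) (j : 'I_p) (i : 'I_n),
     B l j = \sum_(k < m) C (vec_index k l) (vec_index i j)) /\
  (forall (i : 'I_n) (k : 'I_m) (l : 'I_q) (j : 'I_p),
     B l j != 0 ->
     A i k = C (vec_index k l) (vec_index i j) / B l j).
Proof.
have CE k l i j : C (vec_index k l) (vec_index i j) = A i k * B l j.
  have /rowP/(_ (vec_index i j)) := C_def k l.
  by rewrite !mxE vecE mulmx_delta_mulE.
split=> [l j i | i k l j Blj_neq0]; last by rewrite CE GRing.mulfK.
under eq_bigr do rewrite CE.
(* The 1 inserted before [B l j] becomes the l1-norm of row [i]; the two sides then differ only by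
   absolute values, which [A_ge0] removes. *)
rewrite -GRing.mulr_suml -[LHS]GRing.mul1r -(A_l1 i).
by under eq_bigr do rewrite (Num.Theory.ger0_norm (A_ge0 _ _)).
Qed.
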